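(* Let $n\ge2$ and let $T=(T_1,\dots,T_n)$ be a doubly twisted near-isometry on a Hilbert space $\mathcal H$. Then $T$ admits a unique Wold-type decomposition. Moreover, this decomposition is $\mathcal H=\bigoplus_{A\subseteq I_n}\mathcal H_A$, where for nonempty $A\subseteq I_n$ $$\mathcal H_A=\bigoplus_{\boldsymbol k\in\mathbb N_0^{|A|}}T_A^{\boldsymbol k}\Big(\bigcap_{\boldsymbol\ell\in\mathbb N_0^{n-|A|}}T_{I_n\setminus A}^{\boldsymbol\ell}\,\mathcal W_A\Big),\qquad \mathcal W_A=\bigcap_{i\in A}\ker T_i^*,$$ and $\mathcal H_\emptyset=\bigcap_{\boldsymbol\ell\in\mathbb N_0^n}T_{I_n}^{\boldsymbol\ell}\mathcal H$.
   Context: All Hilbert spaces are complex and separable; $I_n=\{1,\dots,n\}$, $\mathbb N_0=\{0,1,2,\dots\}$. An operator $T\in B(\mathcal H)$ is a near-isometry if (i) there is $\delta>0$ with $\delta\|x\|\le\|Tx\|\le\|x\|$ for all $x\in\mathcal H$, and (ii) $T^{*n}T^{n+1}\mathcal H\subseteq T\mathcal H$ for each $n\ge 0$. Let $n\ge2$ and let $\{U_{ij}\}_{1\le i<j\le n}$ be commuting unitaries on $\mathcal H$. An $n$-tuple $(T_1,\dots,T_n)$ of near-isometries on $\mathcal H$ is a doubly twisted near-isometry with respect to $\{U_{ij}\}$ if for all $1\le i<j\le n$ and $1\le k\le n$: $T_i^*T_j=U_{ij}^*T_jT_i^*$, $T_kU_{ij}=U_{ij}T_k$, and $T_iT_j=U_{ij}T_jT_i$.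 For $A=\{a_1<\dots<a_m\}\subseteq I_n$ and $\boldsymbol k\in\mathbb N_0^m$, $T_A^{\boldsymbol k}=T_{a_1}^{k_1}\cdots T_{a_m}^{k_m}$ (the identity if $A=\emptyset$). $T$ is a shift operator on $\mathcal H$ if there is a closed subspace $\mathcal W\subseteq\mathcal H$ with $T^i\mathcal W\perp T^j\mathcal W$ for all non-negative integers $i\neq j$ and $\mathcal H=\bigoplus_{n=0}^\infty T^n\mathcal W$. An $n$-tuple $(T_1,\dots,T_n)$ of near-isometries on $\mathcal H$ admits a Wold-type decomposition if there exist $2^n$ closed subspaces $\{\mathcal H_A\}_{A\subseteq I_n}$ of $\mathcal H$ (possibly zero), each reducing every $T_i$, such that $\mathcal H=\bigoplus_{A\subseteq I_n}\mathcal H_A$ (orthogonal direct sum), $T_i|_{\mathcal H_A}$ is a shift operator if $i\in A$, and $T_i|_{\mathcal H_A}$ is an invertible operator if $i\in I_n\setminus A$. *)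

(* Defs.v *)
From HB Require Import structures.
From mathcomp Require Import all_boot all_order all_algebra.
From mathcomp Require Import sesquilinear.
From mathcomp Require Import complex.
From mathcomp Require Import boolp classical_sets functions cardinality reals.
From mathcomp Require Import topology normedtype.

Set Implicit Arguments.
Unset Strict Implicit.
Unset Printing Implicit Defensive.

Import Order.TTheory GRing.Theory Num.Theory.
Import numFieldNormedType.Exports.

Local Open Scope classical_set_scope.
Local Open Scope ring_scope.
Local Open Scope complex_scope.

(* The inner product is linear in the first argument and conjugate-linear in
   the second one; it induces the norm of the complete normed space [H]. *)
HB.mixin Record CompleteNormedModule_isHilbert (R : realType) H
    of CompleteNormedModule R[i] H := {
  inner : {dot H for (@Num.conj R[i])};
  inner_norm : forall x : H, inner x x = `|x| ^+ 2
}.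

#[short(type="hilbertType")]
HB.structure Definition Hilbert (R : realType) :=
  {H of CompleteNormedModule R[i] H & CompleteNormedModule_isHilbert R H}.

Definition separable (T : topologicalType) : Prop :=
  exists2 D : set T, countable D & dense D.

Section HilbertSpace.
Context {R : realType} {H : hilbertType R}.
Implicit Types (M V W : set H) (S T : H -> H).

(* For a bounded linear [T], Riesz representation gives exactly one such [z];
   [0] is only a default value. *)
Definition adjoint T (y : H) : H :=
  xget 0 [set z | forall x, inner (T x) y = inner x z].

(* [{linear H -> H}] together with [continuous] is B(H). *)
Definition unitary (U : {linear H -> H}) : Prop :=
  [/\ continuous U, cancel U (adjoint U) & cancel (adjoint U) U].

Definition near_isometry (T : {linear H -> H}) : Prop :=
  [/\ continuous T,
      exists2 delta : R, 0 < delta &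
        forall x, delta%:C * `|x| <= `|T x| <= `|x|
    & forall m : nat,
        range (fun x => iter m (adjoint T) (iter m.+1 T x)) `<=` range T].

Definition closed_subspace M : Prop :=
  closed M /\ submod_closed [in M].

Definition orthogonal_sets V W : Prop :=
  forall x y, V x -> W y -> inner x y = 0.

(* [M] is the (internal, Hilbert space) orthogonal direct sum of the [V i]:
   the [V i] are closed subspaces, pairwise orthogonal, and [M] is their closed
   linear span. *)
Definition orthogonal_sum (I : Type) M (V : I -> set H) : Prop :=
  [/\ forall i, closed_subspace (V i),
      forall i j, i <> j -> orthogonal_sets (V i) (V j)
    & M = smallest closed_subspace (\bigcup_i V i)].

Definition reducing T M : Prop :=
  T @` M `<=` M /\ adjoint T @` M `<=` M.

(* The restriction of [T] to an invariant closed subspace [M] is a shift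
   operator on [M]. *)
Definition shift_on T M : Prop :=
  exists W, [/\ closed_subspace W, W `<=` M
    & orthogonal_sum M (fun k : nat => iter k T @` W)].

(* The restriction of the linear map [T] to an invariant closed subspace [M] is
   invertible in B(M); the inverse [S] of a linear bijection is linear. *)
Definition invertible_on T M : Prop :=
  exists S, [/\ S @` M `<=` M,
      {in M, cancel T S}, {in M, cancel S T}
    & {within M, continuous S}].

Section Tuple.
Variables (n : nat) (T : 'I_n -> {linear H -> H}).

(* With A = {a_1 < ... < a_m}, [enum_val] lists A increasingly and
   [mpow A k] is T_{a_1}^{k_1} \o ... \o T_{a_m}^{k_m}. *)
Definition mpow (A : {set 'I_n}) (k : {ffun 'I_#|A| -> nat}) : H -> H :=
  \big[(fun f g : H -> H => f \o g) / idfun]_(j < #|A|)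
    iter (k j) (T (enum_val j)).

(* Only the [U i j] with i < j are relevant. *)
Definition doubly_twisted (U : 'I_n -> 'I_n -> {linear H -> H}) : Prop :=
  [/\ forall i j : 'I_n, (i < j)%N -> unitary (U i j),
      forall i j k l : 'I_n, (i < j)%N -> (k < l)%N ->
        U i j \o U k l =1 U k l \o U i j,
      forall i, near_isometry (T i)
    & forall i j k : 'I_n, (i < j)%N ->
        [/\ adjoint (T i) \o T j =1 adjoint (U i j) \o T j \o adjoint (T i),
            T k \o U i j =1 U i j \o T k
          & T i \o T j =1 U i j \o T j \o T i]].

Definition wold_decomposition (HA : {set 'I_n} -> set H) : Prop :=
  [/\ forall A, closed_subspace (HA A),
      forall A i, reducing (T i) (HA A),
      orthogonal_sum [set: H] HA,
      forall (A : {set 'I_n}) i, i \in A -> shift_on (T i) (HA A)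
    & forall (A : {set 'I_n}) i, i \notin A -> invertible_on (T i) (HA A)].

Definition wandering (A : {set 'I_n}) : set H :=
  [set x | forall i, i \in A -> adjoint (T i) x = 0].

End Tuple.
End HilbertSpace.

(* Main.v *)
(* For one near-isometry T, condition (ii) makes T^k ker T^* orthogonal to
   T^(k+1) H, so that the intersection H_u of the T^m H is the orthogonal
   complement of the span of the T^k ker T^*. Both H_u and its complement H_s
   reduce T; T is invertible on every reducing subspace of H_u, and every reducing
   subspace N of H_s is the orthogonal sum of the T^k (ker T^* \cap N).

   For a tuple, the twisting relations read T_j T_i = T_i V T_j and
   T_j^* T_i = T_i V^* T_j^* with V a unitary commuting with T_i, so T_i^m H, and
   hence H_u(T_i) and H_s(T_i), reduce every T_j. Splitting along T_1, ..., T_n in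
   turn shows that the spaces H_A, obtained by intersecting H_s(T_i) for i in A
   with H_u(T_i) for i not in A, add up to H. In any Wold-type decomposition the
   A-th space is contained in this H_A, hence equal to it. The explicit formula
   follows by applying the one-variable statement to T_i for i in A in turn. *)
Require Import Defs.
From mathcomp Require Import all_boot all_order all_algebra.
From mathcomp Require Import sesquilinear complex boolp.
From mathcomp Require Import classical_sets reals topology normedtype.
From mathcomp Require Import ring lra.

Set Implicit Arguments.
Unset Strict Implicit.
Unset Printing Implicit Defensive.

Import Order.TTheory GRing.Theory Num.Theory.
Import numFieldNormedType.Exports.

Local Open Scope classical_set_scope.
Local Open Scope ring_scope.
Local Open Scope complex_scope.

Section HilbertSpaces.
Context {R : realType} {H : hilbertType R}.
Implicit Types (x y z : H) (a : R[i]) (M N : set H).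

(** * Inner product and real-valued norm *)

Lemma innerC x y : inner x y = (inner y x)^*%C.
Proof. by rewrite hermC expr0 mul1r. Qed.

Lemma innerDl x y z : inner (x + y) z = inner x z + inner y z.
Proof. exact: linearDl. Qed.

Lemma innerZl a x z : inner (a *: x) z = a * inner x z.
Proof. exact: linearZl_LR. Qed.

Lemma innerBl x y z : inner (x - y) z = inner x z - inner y z.
Proof. exact: linearBl. Qed.

Lemma inner0l z : inner 0 z = 0.
Proof. exact: linear0l. Qed.

Lemma innerDr x y z : inner z (x + y) = inner z x + inner z y.
Proof. exact: linearDr. Qed.

Lemma innerBr x y z : inner z (x - y) = inner z x - inner z y.
Proof. exact: linearBr. Qed.

Lemma innerZr a x z : inner z (a *: x) = a^*%C * inner z x.
Proof. by rewrite innerC innerZl rmorphM /= -innerC. Qed.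

Lemma inner0r z : inner z 0 = 0.
Proof. exact: linear0r. Qed.

Lemma inner_eq0C x y : inner x y = 0 -> inner y x = 0.
Proof. by move=> h; rewrite innerC h conjc0. Qed.

Lemma inner_eq0 x : inner x x = 0 -> x = 0.
Proof.
by move/eqP; rewrite inner_norm sqrf_eq0 normr_eq0 => /eqP.
Qed.

Lemma inner_inj x y : (forall z, inner z x = inner z y) -> x = y.
Proof.
move=> h; apply/eqP; rewrite -subr_eq0; apply/eqP/inner_eq0.
by rewrite innerBr h subrr.
Qed.

(** The norm of [H] takes values in [R[i]], which is only partially ordered; its real part lives in
    [R], where infima and [lra] are available. *)
Definition nrm x : R := complex.Re `|x|.

Lemma nrmE x : `|x| = (nrm x)%:C.
Proof. by rewrite RRe_real // normr_real. Qed.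

Lemma nrm_ge0 x : 0 <= nrm x.
Proof. by rewrite -ler0c -nrmE. Qed.

Lemma nrm0 : nrm 0 = 0.
Proof. by rewrite /nrm normr0. Qed.

Lemma nrm_eq0 x : nrm x = 0 -> x = 0.
Proof. by move=> h; apply/eqP; rewrite -normr_eq0 nrmE h. Qed.

Lemma nrmD x y : nrm (x + y) <= nrm x + nrm y.
Proof. by rewrite -lecR rmorphD /= -!nrmE ler_normD. Qed.

Lemma nrmBC x y : nrm (x - y) = nrm (y - x).
Proof. by rewrite /nrm distrC. Qed.

Lemma nrm_dist x y z : nrm (x - z) <= nrm (x - y) + nrm (y - z).
Proof. by apply: le_trans (nrmD _ _); rewrite addrA subrK. Qed.

Lemma inner_nrm x : inner x x = (nrm x ^+ 2)%:C.
Proof. by rewrite inner_norm nrmE rmorphXn. Qed.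

Lemma parallelogram x y :
  nrm (x + y) ^+ 2 + nrm (x - y) ^+ 2 = 2 * nrm x ^+ 2 + 2 * nrm y ^+ 2.
Proof.
rewrite !mulr_natl; apply: (@complexI R).
rewrite !rmorphD/=. rewrite -!inner_nrm !(innerBl, innerBr, innerDl, innerDr).
ring.
Qed.

(** The squared norm of [inner y y *: x - inner x y *: y] is [inner y y] times the difference of the
    squared sides, so that difference is nonnegative. *)
Lemma cauchy_schwarz x y : `|inner x y| <= `|x| * `|y|.
Proof.
have [->|y0] := eqVneq y 0; first by rewrite inner0r !normr0 mulr0.
have yy : 0 < inner y y by rewrite inner_norm exprn_gt0 ?normr_gt0.
have yyc : (inner y y)^*%C = inner y y by rewrite -innerC.
rewrite -(@ler_pXn2r _ 2) ?nnegrE ?mulr_ge0 // exprMn -!inner_norm sqr_normc.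
rewrite -innerC -subr_ge0 -(pmulr_rge0 _ yy).
have := exprn_ge0 2 (normr_ge0 (inner y y *: x - inner x y *: y)).
rewrite -inner_norm !(innerBl, innerBr, innerZl, innerZr) yyc -innerC.
by congr (_ <= _); ring.
Qed.

(** * Norm neighbourhoods and completeness *)

Lemma nbhs_nrmP x (A : set H) :
  nbhs x A <-> exists2 e : R, 0 < e & forall y, nrm (x - y) < e -> A y.
Proof.
split=> [/nbhs_normP[e /= e0 eA]|[e e0 eA]].
  exists (complex.Re e) => [|y xy]; first by move: e0; rewrite ltcE => /andP[].
  apply: eA => /=; rewrite /= nrmE.
  by move: e0; rewrite !ltcE /= => /andP[/eqP -> _]; rewrite eqxx.
apply/nbhs_normP; exists e%:C => /=; first by rewrite ltcR.
by move=> y /=; rewrite nrmE ltcR => /eA.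
Qed.

Lemma closed_nrmP (A : set H) :
  closed A <-> forall x,
    (forall e : R, 0 < e -> exists2 y, A y & nrm (x - y) < e) -> A x.
Proof.
split=> [cA x Ax|h x cx].
  apply: cA => B /nbhs_nrmP[e e0 eB].
  by have [y Ay xy] := Ax e e0; exists y; split=> //; apply: eB.
apply: h => e e0; have [|y [Ay By]] := cx [set y | nrm (x - y) < e].
  by apply/nbhs_nrmP; exists e.
by exists y.
Qed.

(** The sets [G e] generate a filter, Cauchy because their diameters shrink, and [l] is its limit.
    This form of completeness requires no choice of sequences; it serves for nearest points and for
    closed ranges. *)
Lemma cantor_nrm (G : R -> set H) :
  (forall e, 0 < e -> G e !=set0) ->
  (forall d e, 0 < d -> d <= e -> G d `<=` G e) ->
  (forall e, 0 < e -> exists2 d, 0 < d &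
     forall x y, G d x -> G d y -> nrm (x - y) < e) ->
  exists l, forall d e, 0 < d -> 0 < e -> exists2 x, G d x & nrm (l - x) < e.
Proof.
move=> G0 Gle Gc.
pose F := filter_from [set e : R | 0 < e] G.
have FF : ProperFilter F.
  apply: filter_from_proper => [|e /= e0]; last exact: G0.
  apply: filter_from_filter; first by exists 1 => /=.
  move=> d e /= d0 e0; exists (Num.min d e) => /=; first by rewrite lt_min d0.
  move=> x Gx; split; apply: Gle Gx; rewrite ?lt_min ?d0 // ge_min lexx ?orbT //.
have /cauchy_cvg cF : cauchy F.
  apply: cauchy_exP => e e0.
  have re0 : 0 < complex.Re e by move: e0; rewrite ltcE => /andP[].
  have [d d0 dG] := Gc _ re0; have [x Gx] := G0 d d0.
  exists x; exists d => // y Gy; rewrite -ball_normE /= nrmE.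
  move: e0 (dG _ _ Gx Gy); rewrite !ltcE /= => /andP[/eqP -> _] ->.
  by rewrite eqxx.
exists (lim F) => d e d0 e0.
have /cF [c /= c0 cG] : nbhs (lim F) [set y | nrm (lim F - y) < e].
  by apply/nbhs_nrmP; exists e.
have mn : 0 < Num.min c d by rewrite lt_min c0.
have [x Gx] := G0 _ mn; exists x; first by apply: Gle Gx; rewrite // ge_min lexx orbT.
by apply: cG; apply: Gle Gx; rewrite // ge_min lexx.
Qed.

(** * Closed subspaces and orthogonal projections *)

Lemma closed_subspaceP M :
  closed_subspace M <->
  [/\ closed M, M 0 & forall a x y, M x -> M y -> M (a *: x + y)].
Proof.
split=> [[cM [M0 ML]]|[cM M0 ML]].
  split=> //; first by rewrite -inE.
  by move=> a x y Mx My; have := ML a x y; rewrite !inE; apply.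
split=> //; split; first by rewrite inE.
by move=> a x y; rewrite !inE; apply: ML.
Qed.

Section ClosedSubspace.
Variable M : set H.
Hypothesis cM : closed_subspace M.

Lemma subspace_closed : closed M.
Proof. by case: cM. Qed.

Lemma subspace0 : M 0.
Proof. by case/closed_subspaceP : cM. Qed.

Lemma subspaceZ a x : M x -> M (a *: x).
Proof.
by case/closed_subspaceP : cM => _ M0 ML Mx; rewrite -[_ *: _]addr0; apply: ML.
Qed.

Lemma subspaceD x y : M x -> M y -> M (x + y).
Proof.
by case/closed_subspaceP : cM => _ _ ML Mx My; rewrite -[x]scale1r; apply: ML.
Qed.

Lemma subspaceB x y : M x -> M y -> M (x - y).
Proof.
by move=> Mx My; apply: subspaceD => //; rewrite -scaleN1r; apply: subspaceZ.
Qed.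
End ClosedSubspace.

Lemma closed_subspace_bigcap (I : Type) (D : set I) (F : I -> set H) :
  (forall i, D i -> closed_subspace (F i)) -> closed_subspace (\bigcap_(i in D) F i).
Proof.
move=> cF; apply/closed_subspaceP; split.
- by apply: closed_bigI => i /cF[].
- by move=> i /cF /subspace0.
- move=> a x y Fx Fy i Di; have ci := cF i Di.
  by apply: subspaceD => //; [apply: subspaceZ => //; apply: Fx|apply: Fy].
Qed.

Lemma closed_subspaceI M N :
  closed_subspace M -> closed_subspace N -> closed_subspace (M `&` N).
Proof.
move=> cM cN; apply/closed_subspaceP; split.
- by apply: closedI; apply: subspace_closed.
- by split; apply: subspace0.
- by move=> a x y [Mx Nx] [My Ny]; split;
    apply: subspaceD => //; apply: subspaceZ.
Qed.

Definition perp M : set H := [set x | forall y, M y -> inner x y = 0].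

Lemma perp_closed_subspace M : closed_subspace (perp M).
Proof.
apply/closed_subspaceP; split=> [|y _|a x y Mx My z Mz]; last 2 first.
- by rewrite inner0l.
- by rewrite innerDl innerZl Mx // My // mulr0 addr0.
apply/closed_nrmP => x hx z Mz; apply/eqP; apply: contraT => xz.
have z0 : 0 < `|z|.
  by rewrite normr_gt0; apply: contraNneq xz => ->; rewrite inner0r.
have nz0 : 0 < nrm z by rewrite -ltcR -nrmE.
have e0 : 0 < complex.Re `|inner x z| / nrm z.
  by rewrite divr_gt0 //; move: xz; rewrite -normr_gt0 ltcE => /andP[].
have [y My xy] := hx _ e0.
have := cauchy_schwarz (x - y) z.
rewrite innerBl My // subr0 !nrmE -rmorphM /= lecE => /andP[_] /=.
by rewrite leNgt -ltr_pdivlMr // xy.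
Qed.

Lemma perpI M x : M x -> perp M x -> x = 0.
Proof. by move=> Mx /(_ x Mx) /inner_eq0. Qed.

(** Subtracting from [z] its component [c *: m] along [m] lowers the squared norm by |<z,m>|^2 /
    <m,m>; minimality forces this drop to vanish. *)
Lemma min_orthogonal M z : closed_subspace M ->
  (forall m, M m -> nrm z <= nrm (z - m)) -> perp M z.
Proof.
move=> cM zmin m Mm.
have [->|m0] := eqVneq m 0; first by rewrite inner0r.
have mm : 0 < inner m m by rewrite inner_norm exprn_gt0 ?normr_gt0.
have mmc : (inner m m)^*%C = inner m m by rewrite -innerC.
set c := inner z m / inner m m.
have := zmin _ (subspaceZ cM c Mm).
rewrite -(@ler_pXn2r _ 2) ?nnegrE ?nrm_ge0 // -lecR -!inner_nrm.
have -> : inner (z - c *: m) (z - c *: m) =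
    inner z z - `|inner z m| ^+ 2 / inner m m.
  rewrite !(innerBl, innerBr, innerZl, innerZr) sqr_normc (innerC m z).
  rewrite /c fmorph_div /= mmc; field; exact: lt0r_neq0.
rewrite lerBrDr gerDl pmulr_lle0 ?invr_gt0 // => h.
by apply/eqP; rewrite -normr_eq0 -sqrf_eq0 eq_le h exprn_ge0.
Qed.

(** The point [p] is the limit of near-minimizers of the distance from [x] to [M], which are Cauchy
    by the parallelogram law. *)
Lemma projection M x : closed_subspace M -> exists2 p, M p & perp M (x - p).
Proof.
move=> cM.
pose D := [set nrm (x - m) ^+ 2 | m in M].
have D0 : D !=set0 by exists (nrm (x - 0) ^+ 2); exists 0 => //; apply: subspace0.
have Dlb : lbound D 0 by move=> _ [m _ <-]; rewrite exprn_ge0 ?nrm_ge0.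
have Dinf : has_inf D by split=> //; exists 0.
have infD m : M m -> inf D <= nrm (x - m) ^+ 2.
  by move=> Mm; apply: ge_inf; [exists 0|exists m].
pose G e := [set m | M m /\ nrm (x - m) ^+ 2 < inf D + e].
have [||e e0|p pP] := @cantor_nrm G.
- move=> e e0; have [_ [m Mm <-] h] := inf_adherent e0 Dinf.
  by exists m.
- move=> d e d0 de m [Mm h]; split=> //; apply: lt_le_trans h _.
  by rewrite lerD2l.
(* The midpoint of [a] and [b] lies in [M], so the parallelogram law bounds |a - b|^2 by four times
   the allowed excess over [inf D]; an excess of e^2/8 leaves e^2/2. *)
- exists (e ^+ 2 / 8); first by rewrite divr_gt0 ?exprn_gt0.
  move=> a b [Ma ha] [Mb hb].
  have := parallelogram (x - a) (x - b).
  have -> : x - a - (x - b) = b - a by rewrite opprB addrC addrA subrK.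
  have -> : x - a + (x - b) = 2 *: (x - 2^-1 *: (a + b)).
    rewrite scalerBr scalerA divff ?pnatr_eq0 // scale1r scaler_nat mulr2n.
    by rewrite opprD addrACA.
  have := infD _ (subspaceZ cM (2^-1) (subspaceD cM Ma Mb)).
  set c := x - _; have -> : nrm (2 *: c) = 2 * nrm c.
    by rewrite /nrm normrZ normr_nat !nrmE -(rmorph_nat (real_complex R)) -rmorphM.
  rewrite (nrmBC a b) -(@ltr_pXn2r _ 2) ?nnegrE ?nrm_ge0 ?(ltW e0) //.
  move: ha hb; have : 0 < e ^+ 2 by rewrite exprn_gt0.
  rewrite exprMn; lra.
have Mp : M p.
  move/closed_nrmP : (subspace_closed cM); apply => e e0.
  by have [m [Mm _] pm] := pP 1 e ltr01 e0; exists m.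
exists p => //; apply: min_orthogonal => // m Mm; rewrite leNgt; apply/negP.
rewrite -addrA -opprD; set q := p + m => hq.
have Mq : M q by apply: subspaceD.
(* Half the gap between [p] and a supposedly closer [q]: a point [r] of [G (g ^+ 2)] within [g] of
   [p] is farther from [x] than [q] by at least [g], so its squared distance exceeds [inf D] by at
   least g^2. *)
pose g := (nrm (x - p) - nrm (x - q)) / 2.
have g0 : 0 < g by rewrite divr_gt0 // subr_gt0.
have [r [Mr hr] pr] := pP (g ^+ 2) g (exprn_gt0 2 g0) g0.
have := infD _ Mq; have := nrm_dist x r p; have := nrm_ge0 (x - q).
rewrite (nrmBC r) leNgt => q0 t iq; move: hr; apply/negP; rewrite -leNgt.
have h : nrm (x - q) + g <= nrm (x - r) by move: pr t; rewrite /g; lra.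
have : (nrm (x - q) + g) ^+ 2 <= nrm (x - r) ^+ 2.
  by rewrite ler_pXn2r ?nnegrE ?nrm_ge0 // addr_ge0 ?nrm_ge0 // ltW.
have : 0 <= nrm (x - q) * g by rewrite mulr_ge0 ?nrm_ge0 // ltW.
rewrite sqrrD; lra.
Qed.

(** Density of the span becomes a totality test: if [N] is a closed subspace containing every [V i],
    the part of [x] orthogonal to the intersection of [M] and [N] is orthogonal to all [V i], hence
    zero. *)
Lemma orthogonal_sumP (I : Type) M (V : I -> set H) :
  closed_subspace M -> (forall i, closed_subspace (V i)) ->
  (forall i, V i `<=` M) ->
  (forall i j, i <> j -> orthogonal_sets (V i) (V j)) ->
  (forall x, M x -> (forall i, perp (V i) x) -> x = 0) ->
  orthogonal_sum M V.
Proof.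
move=> cM cV VM VV M0; split=> //; apply/seteqP; split; last first.
  by apply: smallest_sub => // x [i _ /VM].
move=> x Mx N [cN VN]; have cMN := closed_subspaceI cM cN.
have [p [Mp Np] xp] := projection x cMN.
rewrite -[x](subrK p) (_ : x - p = 0) ?add0r //; apply: M0.
  exact: subspaceB.
by move=> i y Viy; apply: xp; split; [apply: VM Viy|apply: VN; exists i].
Qed.

Section OrthogonalSum.
Variables (I : Type) (M : set H) (V : I -> set H).
Hypothesis sV : orthogonal_sum M V.

Lemma orthogonal_sum_least N : closed_subspace N -> (forall i, V i `<=` N) -> M `<=` N.
Proof.
by move=> cN VN; case: sV => _ _ ->; apply: smallest_sub => // x [i _ /VN].
Qed.

(** The orthogonal complement of [x] is a closed subspace containing every [V i], so it contains
    [M]. *)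
Lemma orthogonal_sum_perp x : (forall i, perp (V i) x) -> perp M x.
Proof.
move=> xV y My; apply: inner_eq0C; suff /(_ y My) : M `<=` perp [set x] by apply.
apply: orthogonal_sum_least; first exact: perp_closed_subspace.
by move=> i z /xV /inner_eq0C zx _ ->.
Qed.
End OrthogonalSum.

(** * Adjoints and reducing subspaces *)

Lemma reducingP (S : H -> H) M :
  reducing S M <->
  (forall x, M x -> M (S x)) /\ (forall x, M x -> M (adjoint S x)).
Proof.
split=> [[h1 h2]|[h1 h2]]; split.
- by move=> x Mx; apply: h1; exists x.
- by move=> x Mx; apply: h2; exists x.
- by move=> _ [x Mx <-]; apply: h1.
- by move=> _ [x Mx <-]; apply: h2.
Qed.

Lemma reducingI (S : H -> H) M N :
  reducing S M -> reducing S N -> reducing S (M `&` N).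
Proof.
move=> /reducingP[M1 M2] /reducingP[N1 N2].
by apply/reducingP; split=> x [Mx Nx]; split; auto.
Qed.

Lemma orthogonal_split_unique M p p' q q' : closed_subspace M ->
  M p -> M p' -> perp M q -> perp M q' -> p + q = p' + q' -> p = p'.
Proof.
move=> cM Mp Mp' Mq Mq' /eqP; rewrite -subr_eq0 opprD addrACA => /eqP e.
apply/eqP; rewrite -subr_eq0; apply/eqP; apply: (@perpI M).
  exact: subspaceB.
rewrite -[_ - _](addrK (q - q')) e sub0r opprB.
exact: (subspaceB (perp_closed_subspace _)).
Qed.

(** For a closed subspace [M] this is stability of [N] under the orthogonal projection onto [M]. *)
Definition splits M N :=
  forall x p, N x -> M p -> perp M (x - p) -> N p.

(** The orthogonal projection onto [M] is self-adjoint, so it preserves the complement of any set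
    that it preserves. *)
Lemma splits_perp M N : closed_subspace M -> splits M N -> splits M (perp N).
Proof.
move=> cM MN x p Nx Mp xp h Nh; have [h1 Mh1 hh1] := projection h cM.
rewrite -(subrK h1 h) innerDr (inner_eq0C (hh1 _ Mp)) add0r.
have Nh1 := MN _ _ Nh Mh1 hh1.
by have := xp _ Mh1; rewrite innerBl (Nx _ Nh1) sub0r => /eqP; rewrite oppr_eq0 => /eqP.
Qed.

Section Adjoint.
Variable T : {linear H -> H}.
Hypothesis cT : continuous T.

(** The functional sending [x] to <T x, y> has a closed kernel [M]; unless it is zero, a suitable
    multiple of a vector [w] orthogonal to [M] represents it. *)
Lemma riesz y : exists z, forall x, inner (T x) y = inner x z.
Proof.
pose M := [set x | inner (T x) y = 0].
have cM : closed_subspace M.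
  apply/closed_subspaceP; split=> [||a u v].
  - have /continuous_closedP h := cT.
    have -> : M = T @^-1` perp [set y].
      by apply/seteqP; split=> x /= Mx; [move=> _ ->|apply: Mx].
    by apply: h; have [] := perp_closed_subspace [set y].
  - by rewrite /M /= linear0 inner0l.
  - by rewrite /M /= linearP innerDl innerZl => -> ->; rewrite mulr0 addr0.
have [[v Mv]|MT] := pselect (exists v, ~ M v); last first.
  exists 0 => x; rewrite inner0r; apply: contrapT => Mx.
  by apply: MT; exists x.
have [p Mp] := projection v cM; set w := v - p => Mw.
have fw : inner (T w) y != 0.
  by apply/eqP; rewrite /w linearB innerBl Mp subr0.
have ww : inner w w != 0.
  by apply: contra fw => /eqP /inner_eq0 ->; rewrite linear0 inner0l.
exists ((inner (T w) y / inner w w)^*%C *: w) => x.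
rewrite innerZr conjcK.
set c := inner (T x) y / inner (T w) y.
have /Mw : M (x - c *: w).
  by rewrite /M /= linearB linearZ innerBl innerZl divfK // subrr.
move/inner_eq0C; rewrite innerBl innerZl => /eqP; rewrite subr_eq0 => /eqP ->.
rewrite /c; field; exact/andP.
Qed.

Lemma adjointP x y : inner (T x) y = inner x (adjoint T y).
Proof.
by rewrite /adjoint; case: xgetP => [z _ ->//|h]; have [z /h] := riesz y.
Qed.

Lemma adjointPr x y : inner (adjoint T x) y = inner x (T y).
Proof. by rewrite innerC -adjointP -innerC. Qed.

Lemma iter_adjointP k x y :
  inner (iter k T x) y = inner x (iter k (adjoint T) y).
Proof. by elim: k x y => // k IH x y; rewrite iterS adjointP IH -iterSr. Qed.

Lemma adjointD x y : adjoint T (x + y) = adjoint T x + adjoint T y.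
Proof. by apply: inner_inj => z; rewrite innerDr -!adjointP innerDr. Qed.

Lemma adjoint_eq0P x : adjoint T x = 0 <-> perp (range T) x.
Proof.
split=> [Tx _ [y _ <-]|h]; first by rewrite -adjointPr Tx inner0l.
by apply: inner_inj => z; rewrite inner0r -adjointP; apply/inner_eq0C/h; exists z.
Qed.

Lemma reducing_perp M : reducing T M -> reducing T (perp M).
Proof.
move=> /reducingP[M1 M2]; apply/reducingP; split=> x xM y My.
  by rewrite adjointP xM //; apply: M2.
by rewrite adjointPr xM //; apply: M1.
Qed.

Lemma iter_linearB k x y : iter k T (x - y) = iter k T x - iter k T y.
Proof. by elim: k => //= k ->; rewrite linearB. Qed.

Lemma iter_linearD k x y : iter k T (x + y) = iter k T x + iter k T y.
Proof. by elim: k => //= k ->; rewrite linearD. Qed.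

Lemma reducing_iter M k x : reducing T M -> M x -> M (iter k T x).
Proof.
by move=> /reducingP[MT _] Mx; elim: k => //= k; apply: MT.
Qed.

Lemma ker_adjoint_closed : closed_subspace [set x | adjoint T x = 0].
Proof.
rewrite (_ : [set _ | _] = perp (range T)); first exact: perp_closed_subspace.
by apply/seteqP; split=> x /adjoint_eq0P.
Qed.
End Adjoint.

(** * The Wold decomposition of a single near-isometry *)

(** These are H_u and H_s. On H_u the operator is invertible but may fail to be isometric, as for a
    scalar strictly between 0 and 1. *)
Definition unitary_part (T : H -> H) : set H := \bigcap_m range (iter m T).
Definition shift_part (T : H -> H) : set H := perp (unitary_part T).

Section NearIsometry.
Variable T : {linear H -> H}.
Hypothesis nT : near_isometry T.

Let cT : continuous T. Proof. by case: nT. Qed.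

Lemma near_isometry_bounded_below :
  exists2 d : R, 0 < d & forall x, d * nrm x <= nrm (T x).
Proof.
case: nT => _ [d d0 dT] _; exists d => // x; have /andP[h _] := dT x.
by move: h; rewrite !nrmE -rmorphM lecR.
Qed.

Lemma near_isometry_le x : nrm (T x) <= nrm x.
Proof.
by case: nT => _ [d d0 dT] _; have /andP[_] := dT x; rewrite !nrmE lecR.
Qed.

Lemma near_isometry_inj : injective T.
Proof.
move=> x y Txy; have [d d0 dT] := near_isometry_bounded_below.
apply/eqP; rewrite -subr_eq0; apply/eqP/nrm_eq0/eqP.
rewrite eq_le nrm_ge0 andbT -(pmulr_rle0 _ d0).
by rewrite (le_trans (dT _)) // linearB Txy subrr nrm0.
Qed.

Lemma iter_inj k : injective (iter k T).
Proof. by elim: k => // k IH x y /near_isometry_inj /IH. Qed.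

(** If the [T m] approximate [y], the lower bound on [T] makes the points [m] Cauchy; their limit
    lies in [M] and is mapped to [y]. *)
Lemma image_closed_subspace M : closed_subspace M -> closed_subspace (T @` M).
Proof.
move=> cM; have [d d0 dT] := near_isometry_bounded_below.
apply/closed_subspaceP; split; last 2 first.
- by exists 0; [apply: subspace0|rewrite linear0].
- move=> a _ _ [x Mx <-] [y My <-]; exists (a *: x + y); last by rewrite linearP.
  by apply: subspaceD => //; apply: subspaceZ.
apply/closed_nrmP => y hy.
pose G e := [set m | M m /\ nrm (y - T m) < e].
have [e e0|a b a0 ab m [Mm h]|e e0|l lP] := @cantor_nrm G.
- by have [_ [m Mm <-] h] := hy e e0; exists m.
- by split=> //; apply: lt_le_trans ab.
- exists (d * e / 2) => [|x z [Mx hx] [Mz hz]]; first by rewrite divr_gt0 ?mulr_gt0.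
  rewrite -(ltr_pM2l d0); apply: le_lt_trans (dT _) _; rewrite linearB.
  apply: le_lt_trans (nrm_dist _ y _) _; rewrite (nrmBC (T x)); lra.
exists l.
  move/closed_nrmP : (subspace_closed cM); apply => e e0.
  by have [m [Mm _] lm] := lP 1 e ltr01 e0; exists m.
apply/eqP; rewrite eq_sym -subr_eq0; apply/eqP/nrm_eq0/eqP.
rewrite eq_le nrm_ge0 andbT; apply/ler_addgt0Pl => e e0; rewrite addr0.
have e2 : 0 < e / 2 by rewrite divr_gt0.
have [m [Mm ym] lm] := lP _ _ e2 e2.
apply: le_trans (nrm_dist _ (T m) _) _; rewrite -(linearB T m).
have := near_isometry_le (m - l); rewrite (nrmBC m); lra.
Qed.

Lemma iter_image_closed_subspace k M :
  closed_subspace M -> closed_subspace (iter k T @` M).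
Proof.
move=> cM; elim: k => [|k IH]; first by rewrite image_id.
rewrite (_ : iter k.+1 T = T \o iter k T) // -image_comp.
exact: image_closed_subspace.
Qed.

(** Here condition (ii) enters: after moving [iter k T] across the inner product, the right argument
    lies in the range of [T], to which [w] is orthogonal. The surplus of [l] over [k.+1] is absorbed
    into [z]. *)
Lemma wandering_iter k l x w :
  (k < l)%N -> adjoint T w = 0 -> inner (iter k T w) (iter l T x) = 0.
Proof.
move=> kl Tw; rewrite -(subnKC kl) iterD; set z := iter (_ - _) T x.
have [_ _ /(_ k) h] := nT; rewrite iter_adjointP //.
have [|u _ <-] := h (iter k (adjoint T) (iter k.+1 T z)); first by exists z.
by rewrite -adjointPr // Tw inner0l.
Qed.

(** For the converse, write x = T^m z and z = T u + w with [w] orthogonal to the range of [T]. Both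
    [x] and T^(m+1) u are orthogonal to T^m w, so T^m w = 0 and x = T^(m+1) u. *)
Lemma unitary_partP x :
  unitary_part T x <-> forall k w, adjoint T w = 0 -> inner x (iter k T w) = 0.
Proof.
split=> [Tx k w Tw|xT m _].
  have [z _ <-] := Tx k.+1 Logic.I.
  by apply/inner_eq0C/wandering_iter.
elim: m => [|m [z _ zx]]; first by exists x.
have cTH : closed_subspace (range T).
  by apply: image_closed_subspace; apply/closed_subspaceP; split=> //; apply: closedT.
have [_ [u _ <-] zu] := projection z cTH; set w := z - T u in zu.
have Tw : adjoint T w = 0 by apply/adjoint_eq0P.
exists u => //; rewrite -zx iterSr -[in RHS](subrK (T u) z) iter_linearD.
rewrite (_ : iter m T w = 0) ?add0r //; apply: inner_eq0.
have := xT m w Tw; rewrite -zx -[z](subrK (T u)) iter_linearD innerDl -iterSr.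
have /inner_eq0C -> : inner (iter m T w) (iter m.+1 T u) = 0 by apply: wandering_iter.
by rewrite addr0.
Qed.

Lemma unitary_part_closed : closed_subspace (unitary_part T).
Proof.
rewrite (_ : unitary_part T =
  perp [set y | exists k w, adjoint T w = 0 /\ y = iter k T w]).
  exact: perp_closed_subspace.
apply/seteqP; split=> x; first by move=> /unitary_partP h _ [k [w [Tw ->]]]; exact: h.
by move=> h; apply/unitary_partP => k w Tw; apply: h; exists k, w.
Qed.

Lemma shift_part_wandering k w : adjoint T w = 0 -> shift_part T (iter k T w).
Proof. by move=> Tw y /unitary_partP/(_ k w Tw)/inner_eq0C. Qed.

Lemma unitary_part_reducing : reducing T (unitary_part T).
Proof.
apply/reducingP; split=> x Tx.
  case=> [|m] _; first by exists (T x).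
  by have [z _ <-] := Tx m Logic.I; exists z.
apply/unitary_partP => k w Tw; rewrite adjointPr //.
by move/unitary_partP : Tx => /(_ k.+1 w Tw).
Qed.

Section Reducing.
Variable N : set H.
Hypotheses (cN : closed_subspace N) (rN : reducing T N).

(** Powers of [T] respect the splitting along [N] and its complement, so the complementary part of
    [x] is sent to zero; injectivity concludes. *)
Lemma reducing_iter_inv m x : N (iter m T x) -> N x.
Proof.
move=> Nx; have [p Np xp] := projection x cN.
suff /iter_inj -> : iter m T x = iter m T p by [].
apply: (@orthogonal_split_unique N _ _ 0 (iter m T (x - p))) => //.
- exact: reducing_iter.
- exact/(subspace0 (perp_closed_subspace _)).
- by apply: reducing_iter xp; apply: reducing_perp.
- by rewrite addr0 iter_linearB addrC subrK.
Qed.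

(** The projection onto [N] commutes with T^m, so it maps T^m z to T^m p' with p' the projection of
    [z]. *)
Lemma splits_unitary_part : splits N (unitary_part T).
Proof.
move=> x p Tx Np xp m _; have [z _ zx] := Tx m Logic.I.
have [p' Np' zp'] := projection z cN; exists p' => //.
apply: (@orthogonal_split_unique N _ _ (iter m T (z - p')) (x - p)) => //.
- exact: reducing_iter.
- by apply: reducing_iter zp'; apply: reducing_perp.
- by rewrite -iter_linearD addrC subrK zx addrC subrK.
Qed.

Lemma unitary_part_onto x : N `<=` unitary_part T -> N x ->
  exists2 y, N y & T y = x.
Proof.
move=> NT Nx; have [y _ yx] := NT x Nx 1 Logic.I.
by exists y => //; apply: (@reducing_iter_inv 1); rewrite yx.
Qed.

(** Totality of the T^k (ker T^* \cap N) in [N]. The projection [p] of [x] onto [N] lies in H_s;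
    testing it against all wandering vectors puts it in H_u as well, so it vanishes. *)
Lemma shift_part_perp x : N `<=` shift_part T ->
  (forall k w, adjoint T w = 0 -> N w -> inner x (iter k T w) = 0) -> perp N x.
Proof.
move=> NT xw; have [p Np xp] := projection x cN.
suff p0 : p = 0 by rewrite p0 subr0 in xp.
apply: (perpI _ (NT p Np)); apply/unitary_partP => k w Tw.
have [v Nv wv] := projection w cN.
(* T^* w = 0 is the sum of T^* v in [N] and T^* (w - v) in its complement, so both terms vanish. *)
have Tv : adjoint T v = 0.
  have [_ rN2] := (reducingP _ _).1 rN.
  have [_ pN2] := (reducingP _ _).1 (reducing_perp cT rN).
  apply: (perpI (rN2 _ Nv)) => y Ny.
  have /eqP : adjoint T v + adjoint T (w - v) = 0.
    by rewrite -adjointD // addrC subrK.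
  by rewrite addr_eq0 => /eqP ->; rewrite -scaleN1r innerZl pN2 // mulr0.
rewrite -(subrK v w) iter_linearD innerDr.
have -> : inner p (iter k T (w - v)) = 0.
  apply: inner_eq0C; apply: (reducing_iter _ (reducing_perp cT rN) wv) => //.
rewrite add0r; have := xw k v Tv Nv; rewrite -[x](subrK p) innerDl.
by rewrite (xp _ (reducing_iter _ rN Nv)) add0r.
Qed.

Lemma shift_part_shift_on : N `<=` shift_part T -> shift_on T N.
Proof.
move=> NT; exists ([set x | adjoint T x = 0] `&` N); split.
- exact: closed_subspaceI (ker_adjoint_closed cT) cN.
- by move=> x [].
- apply: orthogonal_sumP => //.
  + move=> k; apply: iter_image_closed_subspace.
    exact: closed_subspaceI (ker_adjoint_closed cT) cN.
  + by move=> k _ [x [_ Nx] <-]; apply: reducing_iter.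
  + move=> k l /eqP; rewrite neq_ltn => /orP kl _ _ [x [Tx _] <-] [y [Ty _] <-].
    by case: kl => kl; [|apply: inner_eq0C]; apply: wandering_iter.
  + move=> x Nx xT; apply: (perpI Nx); apply: shift_part_perp => // k w Tw Nw.
    by apply: (xT k); exists w.
Qed.

Lemma unitary_part_invertible_on : N `<=` unitary_part T -> invertible_on T N.
Proof.
move=> NT; have [rN1 _] := (reducingP _ _).1 rN.
(* The default 0 is taken only off the range of [T], hence never on [N]. *)
pose S x := xget 0 [set y | T y = x].
have TK y : S (T y) = y.
  by rewrite /S; case: xgetP => [z _ /= /near_isometry_inj|/(_ y)] //=.
have SN x : N x -> N (S x) /\ T (S x) = x.
  by move=> Nx; have [y Ny <-] := unitary_part_onto NT Nx; rewrite TK.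
exists S; split.
- by move=> _ [x /SN[Nx _] <-].
- by move=> x _; apply: TK.
- by move=> x; rewrite inE => /SN[].
apply/subspace_continuousP => x Nx B /nbhs_nrmP[e e0 eB].
have [d d0 dT] := near_isometry_bounded_below.
apply/nbhs_nrmP; exists (d * e) => [|y xy Ny]; first exact: mulr_gt0.
apply: eB; rewrite -(ltr_pM2l d0); apply: le_lt_trans (dT _) _.
by rewrite linearB (SN _ Nx).2 (SN _ Ny).2.
Qed.

(* The generating subspace of the shift lies in [ker T^*]: it is orthogonal to
   [T N], and to the image of [perp N] because [perp N] reduces [T]. *)
Lemma shift_on_sub : shift_on T N -> N `<=` shift_part T.
Proof.
move=> [W [cW WN sN]]; apply: (orthogonal_sum_least sN).
  exact: perp_closed_subspace.
move=> k _ [w Ww <-]; apply: shift_part_wandering; apply/adjoint_eq0P => //.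
move=> _ [y _ <-]; have [p Np yp] := projection y cN.
rewrite -[y](subrK p) linearD innerDr.
have [_ pN2] := (reducingP _ _).1 (reducing_perp cT rN).
rewrite (inner_eq0C (_ : inner (T (y - p)) w = 0)) ?add0r; last first.
  have [pN1 _] := (reducingP _ _).1 (reducing_perp cT rN).
  exact/pN1/WN.
suff /(_ p Np) : N `<=` [set y | inner (T y) w = 0] by move/inner_eq0C.
rewrite (_ : [set _ | _] = perp [set adjoint T w]); last first.
  by apply/seteqP; split=> z /=; rewrite ?adjointP// => h; [move=> _ ->|apply: h].
apply: (orthogonal_sum_least sN); first exact: perp_closed_subspace.
move=> l _ [v Wv <-] _ ->; rewrite -adjointP //.
case: sN => _ /(_ l.+1 0) h _; apply: h => //; first by exists v.
by exists w.
Qed.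

Lemma invertible_on_sub : invertible_on T N -> N `<=` unitary_part T.
Proof.
move=> [S [SN _ TS _]] x Nx m _; exists (iter m S x) => //.
have SNx k : N (iter k S x) by elim: k => //= k IH; apply: SN; exists (iter k S x).
by elim: m => // m IH; rewrite iterSr /= TS // inE.
Qed.
End Reducing.
End NearIsometry.

(** * Doubly twisted tuples *)

(** Each crossing of a factor [S] by [X] leaves one [Y]; since [Y] commutes with [S], these collect
    on the right. *)
Lemma iter_twist (X Y S : H -> H) m x :
  (forall y, X (S y) = S (Y (X y))) -> (forall y, Y (S y) = S (Y y)) ->
  X (iter m S x) = iter m S (iter m Y (X x)).
Proof.
move=> XS YS; elim: m => //= m IH; rewrite XS IH; congr S.
by elim: m {IH} (iter m Y _) => //= m IH y; rewrite YS IH.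
Qed.

Section DoublyTwisted.
Variables (n : nat) (T : 'I_n -> {linear H -> H}).
Variable U : 'I_n -> 'I_n -> {linear H -> H}.
Hypothesis TU : doubly_twisted T U.
Implicit Types (A B : {set 'I_n}) (s : seq 'I_n) (k : 'I_n -> nat).

Let nT i : near_isometry (T i). Proof. by case: TU. Qed.
Let cT i : continuous (T i). Proof. by case: (nT i). Qed.

(* The two twisting relations, in a form that is symmetric in [i] and [j]:
   [V] is either [U i j]^* or [U j i], and [V'] is its adjoint. *)
Lemma twist i j : i != j -> exists V V' : H -> H,
  [/\ forall x y, inner (V x) y = inner x (V' y),
      forall x, V (T i x) = T i (V x) /\ V' (T i x) = T i (V' x),
      forall x, T j (T i x) = T i (V (T j x))
    & forall x, adjoint (T j) (T i x) = T i (V' (adjoint (T j) x))].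
Proof.
case: TU => unU _ _ tw ij.
have comm (a b c : 'I_n) (ab : (a < b)%N) x :
    T c (adjoint (U a b) x) = adjoint (U a b) (T c x).
  have [_ UK KU] := unU _ _ ab; apply: (can_inj UK).
  by have [_ TUc _] := tw _ _ c ab; rewrite -[LHS]TUc /= !KU.
have comm' (a b c : 'I_n) (ab : (a < b)%N) x :
    adjoint (T c) (U a b x) = U a b (adjoint (T c) x).
  have [cU UK KU] := unU _ _ ab; apply: inner_inj => z.
  by rewrite -adjointP // -adjointPr // -comm // adjointP // adjointPr.
move: ij; rewrite neq_ltn => /orP[ij|ji].
- have [cU UK KU] := unU _ _ ij; exists (adjoint (U i j)), (U i j).
  split=> [x y|x|x|x]; first by rewrite adjointPr.
  + by rewrite comm //; have [_ /(_ x) /= -> _] := tw _ _ i ij.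
  + by rewrite comm //; have [_ _ /(_ x) /= ->] := tw _ _ i ij; rewrite UK.
  (* The hypothesis gives T_i^* T_j for i < j; the relation for T_j^* T_i is its adjoint, with
     [U i j] then moved past T_j^*. *)
  + apply: inner_inj => z; rewrite -adjointP // -adjointPr //.
    have [/(_ z) /= -> _ _] := tw _ _ i ij.
    by rewrite adjointPr // adjointP // adjointPr // comm'.
- have [cU UK KU] := unU _ _ ji; exists (U j i), (adjoint (U j i)).
  split=> [x y|x|x|x]; first by rewrite adjointP.
  + by rewrite comm //; have [_ /(_ x) /= -> _] := tw _ _ i ji.
  + have [_ _ /(_ x) /= ->] := tw _ _ i ji.
    by have [_ /(_ (T j x)) /= -> _] := tw _ _ i ji.
  + by have [/(_ x) /= -> _ _] := tw _ _ i ji; rewrite comm.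
Qed.

Lemma range_iter_reducing i j m : i != j -> reducing (T j) (range (iter m (T i))).
Proof.
move=> /twist[V [V' [_ VT TT aTT]]].
apply/reducingP; split=> _ [x _ <-].
  exists (iter m V (T j x)) => //.
  by rewrite (@iter_twist (T j) V (T i)) // => y; case: (VT y).
exists (iter m V' (adjoint (T j) x)) => //.
by rewrite (@iter_twist (adjoint (T j)) V' (T i)) // => y; case: (VT y).
Qed.

Lemma unitary_part_reducing_all i j : reducing (T j) (unitary_part (T i)).
Proof.
have [->|ij] := eqVneq i j; first exact: unitary_part_reducing.
apply/reducingP; split=> x Tx m _;
  have /reducingP[h1 h2] := range_iter_reducing m ij.
- by apply: h1; apply: Tx.
- by apply: h2; apply: Tx.
Qed.

Lemma shift_part_reducing_all i j : reducing (T j) (shift_part (T i)).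
Proof. exact: (reducing_perp (@cT j) (unitary_part_reducing_all i j)). Qed.

Lemma ker_adjoint_reducing i j : i != j ->
  reducing (T j) [set x | adjoint (T i) x = 0].
Proof.
move=> ij; rewrite (_ : [set _ | _] = perp (range (iter 1 (T i)))).
  exact/reducing_perp/range_iter_reducing.
by apply/seteqP; split=> x /adjoint_eq0P; apply.
Qed.

(** Moving [T j] past [iter m (T i)] costs [iter m V]. Both [T j] and [V] preserve the kernel of
    T_i^*, the latter because its adjoint [V'] commutes with [T i]. *)
Lemma wandering_iter_invariant i j l m w : i != j -> adjoint (T i) w = 0 ->
  exists2 w', adjoint (T i) w' = 0 &
    iter l (T j) (iter m (T i) w) = iter m (T i) w'.
Proof.
move=> ij Tw; elim: l => [|l [w' Tw' /= ->]]; first by exists w.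
have [V [V' [VV VT TT _]]] := twist ij.
exists (iter m V (T j w')); last first.
  by rewrite (@iter_twist (T j) V (T i)) // => y; case: (VT y).
have Tjw : adjoint (T i) (T j w') = 0.
  by have /reducingP[h _] := ker_adjoint_reducing ij; apply: h.
elim: m => //= m; set z := iter m V _ => Tz.
apply/adjoint_eq0P => // _ [y _ <-].
by rewrite VV (VT y).2 -adjointPr // Tz inner0l.
Qed.

(** * The spaces H_A: decomposition and uniqueness *)

Definition component A i : set H :=
  if i \in A then shift_part (T i) else unitary_part (T i).

Definition wold_part A : set H := \bigcap_i component A i.

Lemma component_closed A i : closed_subspace (component A i).
Proof.
rewrite /component; case: ifP => _; first exact: perp_closed_subspace.
exact: unitary_part_closed.
Qed.

Lemma component_reducing A i j : reducing (T j) (component A i).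
Proof.
rewrite /component; case: ifP => _; first exact: shift_part_reducing_all.
exact: unitary_part_reducing_all.
Qed.

Lemma splits_component N A i :
  closed_subspace N -> reducing (T i) N -> splits N (component A i).
Proof.
move=> cN rN; rewrite /component; case: ifP => _.
  exact/splits_perp/splits_unitary_part.
exact: splits_unitary_part.
Qed.

Lemma wold_part_closed A : closed_subspace (wold_part A).
Proof. by apply: closed_subspace_bigcap => i _; apply: component_closed. Qed.

Lemma wold_part_reducing A j : reducing (T j) (wold_part A).
Proof.
apply/reducingP; split=> x Ax i _; have /reducingP[h1 h2] := component_reducing A i j.
- by apply: h1; apply: Ax.
- by apply: h2; apply: Ax.
Qed.

Lemma wold_part_shift A i : i \in A -> wold_part A `<=` shift_part (T i).
Proof. by move=> iA x /(_ i Logic.I); rewrite /component iA. Qed.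

Lemma wold_part_unitary A i : i \notin A -> wold_part A `<=` unitary_part (T i).
Proof. by move=> iA x /(_ i Logic.I); rewrite /component (negPf iA). Qed.

Lemma wold_part_orthogonal A B :
  A <> B -> orthogonal_sets (wold_part A) (wold_part B).
Proof.
move=> AB x y Ax By; have [i + ] : exists i, (i \in A) != (i \in B).
  apply: contrapT => h; apply: AB; apply/finset.setP => i; apply/eqP.
  by apply: contrapT => /negP iAB; apply: h; exists i.
have [iA|iA] := boolP (i \in A) => iB.
  by apply: (wold_part_shift iA Ax); apply: (wold_part_unitary _ By); case: (i \in B) iB.
apply: inner_eq0C; have iB' : i \in B by case: (i \in B) iB.
by apply: (wold_part_shift iB' By); apply: (wold_part_unitary iA Ax).
Qed.

(** The claim is generalized to intersections over a list of indices and proved by induction on the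
    list; over the empty list the intersection is the whole space, so [x] is orthogonal to
    itself. *)
Lemma wold_part_total x : (forall A, perp (wold_part A) x) -> x = 0.
Proof.
move=> xA.
suff h : forall s, uniq s ->
    (forall A, perp (\bigcap_(i in [set i | i \in s]) component A i) x) -> x = 0.
  apply: (h (enum 'I_n)) => [|A y Ay]; first exact: enum_uniq.
  by apply: (xA A) => i _; apply: Ay; rewrite /= mem_enum.
elim=> [_ h|i s IH /= /andP[is_ us] h].
  by apply/inner_eq0/(h finset.set0).
apply: IH => // A y Ay.
have cU := unitary_part_closed (nT i).
have [p Up yp] := projection y cU.
rewrite -[y](subrK p) innerDr.
(* H_u(T_i) reduces [T j], so projecting onto it stays inside the component of index [j]. *)
have Ap j : j \in s -> component A j p.
  move=> js; suff spl : splits (unitary_part (T i)) (component A j).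
    exact: spl (Ay j js) Up yp.
  by apply: splits_component => //; apply: unitary_part_reducing_all.
(* The part [y - p], in H_s(T_i), is tested against [i |: A], and [p], in H_u(T_i), against
   [A :\ i]. *)
rewrite (h (i |: A)%SET) ?add0r; last first.
  move=> j; rewrite /= inE => /predU1P[->|js].
    by rewrite /component finset.setU11.
  have -> : component (i |: A)%SET j = component A j.
    rewrite /component finset.in_setU1; case: eqP => // ji.
    by rewrite -ji js in is_.
  by apply: subspaceB (component_closed _ _) _ _ _ _; [exact: Ay|exact: Ap].
rewrite (h (A :\ i)%SET) //.
move=> j; rewrite /= inE => /predU1P[->|js].
  by rewrite /component finset.setD11.
have -> : component (A :\ i)%SET j = component A j.
  rewrite /component finset.in_setD1; case: eqP => // ji.
  by rewrite -ji js in is_.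
exact: Ap.
Qed.

Lemma wold_part_decomposition : wold_decomposition T wold_part.
Proof.
split=> [A|A i||A i iA|A i iA].
- exact: wold_part_closed.
- exact: wold_part_reducing.
- apply: orthogonal_sumP => //.
  + by apply/closed_subspaceP; split=> //; apply: closedT.
  + exact: wold_part_closed.
  + exact: wold_part_orthogonal.
  + by move=> x _ /wold_part_total.
- apply: (shift_part_shift_on (nT i) (wold_part_closed A)).
    exact: wold_part_reducing.
  exact: wold_part_shift.
- apply: (unitary_part_invertible_on (nT i) (wold_part_closed A)).
    exact: wold_part_reducing.
  exact: wold_part_unitary.
Qed.

(** Each [HA A] lies in [wold_part A]. Conversely, for [x] in [wold_part A], what remains after
    projecting onto [HA A] is orthogonal to every [HA B], hence to [H]. *)
Lemma wold_decomposition_unique HA : wold_decomposition T HA -> HA = wold_part.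
Proof.
move=> [cHA rHA sHA shHA inHA].
have sub A : HA A `<=` wold_part A.
  move=> x Ax i _; rewrite /component; case: ifPn => iA.
    exact: (shift_on_sub (nT i) (cHA A) (rHA A i) (shHA _ _ iA)).
  exact: (invertible_on_sub (inHA _ _ iA)).
apply/funext => A; apply/seteqP; split=> // x Ax.
have [p Ap xp] := projection x (cHA A).
suff /(_ (x - p) Logic.I) /inner_eq0/eqP : perp [set: H] (x - p).
  by rewrite subr_eq0 => /eqP ->.
apply: (orthogonal_sum_perp sHA) => B.
have [<- //|/eqP AB y By] := eqVneq A B.
apply: (wold_part_orthogonal AB); last exact: sub.
by apply: (subspaceB (wold_part_closed A)) => //; apply: sub.
Qed.

(* [mpow] along a list of indices, so that products can be handled by induction
   on the list. *)
Definition lpow s k : H -> H := foldr (fun i f => iter (k i) (T i) \o f) idfun s.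

Lemma eq_lpow s k k' : {in s, k =1 k'} -> lpow s k = lpow s k'.
Proof.
elim: s => //= i s IH kk'; rewrite kk' ?mem_head // IH // => j js.
by apply: kk'; rewrite inE js orbT.
Qed.

Lemma lpow_single s i m x : uniq s ->
  lpow s (fun j => if j == i then m else 0%N) x =
  if i \in s then iter m (T i) x else x.
Proof.
elim: s => //= j s IH /andP[js us]; rewrite inE IH //.
have [ji|ij] := eqVneq j i; last by [].
by rewrite -ji (negPf js).
Qed.

Lemma lpow_reducing s k x N :
  (forall i, i \in s -> reducing (T i) N) -> N x -> N (lpow s k x).
Proof.
elim: s => //= i s IH rN Nx; apply: reducing_iter; first exact/rN/mem_head.
by apply: IH => // j js; apply: rN; rewrite inE js orbT.
Qed.

Lemma lpow_closed s k N : closed_subspace N -> closed_subspace (lpow s k @` N).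
Proof.
move=> cN; elim: s => [|i s IH]; first by rewrite image_id.
rewrite (_ : lpow _ _ = iter (k i) (T i) \o lpow s k) // -image_comp.
exact: iter_image_closed_subspace.
Qed.

Lemma lpow_onto s k N : closed_subspace N ->
  (forall i, i \in s -> reducing (T i) N /\ N `<=` unitary_part (T i)) ->
  N `<=` lpow s k @` N.
Proof.
move=> cN; elim: s => [|i s IH] sN x Nx; first by exists x.
have [rN uN] := sN i (mem_head _ _).
have [y Ny <-] : exists2 y, N y & iter (k i) (T i) y = x.
  elim: (k i) => [|m [y Ny <-]]; first by exists x.
  have [z Nz <-] := unitary_part_onto (nT i) cN rN uN Ny.
  by exists z => //; rewrite iterSr.
have [|z Nz <-] := IH _ y Ny; last by exists z.
by move=> j js; apply: sN; rewrite inE js orbT.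
Qed.

(** Factors to the right of the power of [T i] preserve the kernel of T_i^*; those to its left are
    moved past it at the cost of changing the wandering vector. *)
Lemma lpow_wandering s k i x : uniq s -> i \in s -> adjoint (T i) x = 0 ->
  exists2 w, adjoint (T i) w = 0 & lpow s k x = iter (k i) (T i) w.
Proof.
move=> us si Tx; elim: s us si => //= j s IH /andP[js us]; rewrite inE.
have [ij _|ij /= si] := eqVneq i j.
  subst j; exists (lpow s k x) => //; rewrite -/([set x | adjoint (T i) x = 0] _).
  apply: lpow_reducing => // l ls; apply: ker_adjoint_reducing.
  by apply: contraNneq js => ->.
have [w Tw ->] := IH us si.
exact: wandering_iter_invariant.
Qed.

(** The one-variable statement for the head [i] leaves tests against T_i^m w with [w] in N' = ker
    T_i^* \cap N. Moving T_i^m onto [x] allows induction with N', which still reduces the remaining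
    operators. *)
Lemma lpow_total s N x : uniq s -> closed_subspace N ->
  (forall i, i \in s -> reducing (T i) N /\ N `<=` shift_part (T i)) ->
  (forall k y, N y -> (forall i, i \in s -> adjoint (T i) y = 0) ->
    inner x (lpow s k y) = 0) ->
  perp N x.
Proof.
elim: s N x => [|i s IH] N x /=.
  by move=> _ _ _ h y Ny; apply: (h (fun=> 0%N)).
move=> /andP[is_ us] cN sN h; have [rN hN] := sN i (mem_head _ _).
apply: (shift_part_perp (nT i) cN rN hN) => m w Tw Nw.
apply: inner_eq0C; rewrite iter_adjointP //; apply: inner_eq0C.
pose N' := [set y | adjoint (T i) y = 0] `&` N.
have cN' : closed_subspace N'.
  exact: closed_subspaceI (ker_adjoint_closed (@cT i)) cN.
suff : perp N' (iter m (adjoint (T i)) x) by apply.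
apply: IH => // [j js|k y [Ty Ny] sy].
  have /sN[rj hj] : j \in i :: s by rewrite inE js orbT.
  split; last by move=> z [_ /hj].
  apply: reducingI => //; apply: ker_adjoint_reducing.
  by apply: contraNneq is_ => ->.
(* Since [i] is not in [s], prescribing the exponent [m] at [i] leaves [lpow s] unchanged. *)
pose k' j := if j == i then m else k j.
have ki : k' i = m by rewrite /k' eqxx.
have ks : lpow s k' = lpow s k.
  by apply: eq_lpow => j js; rewrite /k'; case: eqP js is_ => // -> ->.
apply: inner_eq0C; rewrite -iter_adjointP //; apply: inner_eq0C.
rewrite -ki -ks; apply: (h k' y Ny) => j.
by rewrite inE => /predU1P[->|/sy].
Qed.

(** Exponents are extended by 0 outside [A], so that they become functions on all indices and can be
    modified one index at a time. *)
Lemma mpowE A (l : {ffun 'I_#|A| -> nat}) :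
  exists2 k, mpow T l = lpow (enum A) k & forall j, k (enum_val j) = l j.
Proof.
pose k i := if [pick j : 'I_#|A| | enum_val j == i] is Some j then l j else 0%N.
have kE j : k (enum_val j) = l j.
  by rewrite /k; case: pickP => [j' /eqP/enum_val_inj ->//|/(_ j)]; rewrite eqxx.
exists k => //; rewrite /mpow.
rewrite (eq_bigr (fun j => iter (k (enum_val j)) (T (enum_val j)))); last first.
  by move=> j _; rewrite kE.
have enumE : [seq enum_val j | j <- enum 'I_#|A|] = enum A.
  case sA: (enum A) => [|x0 s].
    by apply: size0nil; rewrite size_map size_enum_ord cardE sA.
  rewrite -sA -[RHS](mkseq_nth x0) /mkseq -cardE -val_enum_ord -map_comp.
  by apply: eq_map => j; apply: enum_val_nth.
rewrite -enumE [index_enum _]unlock -enumT.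
by elim: (enum 'I_#|A|) => [|j s IH]; rewrite ?big_nil // big_cons /= IH.
Qed.

Lemma lpow_mpow A k :
  lpow (enum A) k = mpow T [ffun j : 'I_#|A| => k (enum_val j)].
Proof.
have [k' -> k'E] := mpowE [ffun j : 'I_#|A| => k (enum_val j)].
apply: eq_lpow => i; rewrite mem_enum => iA.
by rewrite -(enum_rankK_in iA iA) k'E ffunE.
Qed.

(** Zero exponents give membership in [N], and exponents concentrated at one [i] in [B] give the
    range of each power of [T i]. Conversely every [T i] with [i] in [B] maps the right-hand side
    onto itself. *)
Lemma bigcap_mpow B N : closed_subspace N ->
  (forall i, i \in B -> reducing (T i) N) ->
  \bigcap_(l : {ffun 'I_#|B| -> nat}) (mpow T l @` N) =
  N `&` \bigcap_(i in [set i | i \in B]) unitary_part (T i).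
Proof.
move=> cN rN; apply/seteqP; split=> x hx.
  split.
    have [y Ny <-] := hx [ffun j => 0%N] Logic.I.
    have [k -> _] := mpowE [ffun j : 'I_#|B| => 0%N].
    by apply: lpow_reducing => // i; rewrite mem_enum; apply: rN.
  move=> i /= iB m _.
  pose k j := if j == i then m else 0%N.
  have [y Ny <-] := hx [ffun j => k (enum_val j)] Logic.I.
  by rewrite -lpow_mpow lpow_single ?enum_uniq // mem_enum iB; exists y.
move=> l _; have [k -> _] := mpowE l.
have [y [Ny _] <-] : (lpow (enum B) k @`
    (N `&` \bigcap_(i in [set i | i \in B]) unitary_part (T i))) x.
  apply: lpow_onto => // [|i].
    apply: closed_subspaceI => //; apply: closed_subspace_bigcap => i _.
    exact: unitary_part_closed.
  rewrite mem_enum => iB; split; last by move=> z [_]; apply.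
  apply: reducingI; first exact: rN.
  apply/reducingP; split=> z hz j jB;
    have /reducingP[h1 h2] := unitary_part_reducing_all j i.
  - exact/h1/hz.
  - exact/h2/hz.
by exists y.
Qed.

Lemma wandering_closed A : closed_subspace (wandering T A).
Proof.
rewrite (_ : wandering T A =
  \bigcap_(i in [set i | i \in A]) [set x | adjoint (T i) x = 0]) //.
by apply: closed_subspace_bigcap => i _; apply: ker_adjoint_closed.
Qed.

Lemma wandering_reducing A i : i \notin A -> reducing (T i) (wandering T A).
Proof.
move=> iA; apply/reducingP; split=> x Ax j jA;
  have /ker_adjoint_reducing/reducingP[h1 h2] : j != i
    by apply: contraNneq iA => <-.
- exact/h1/Ax.
- exact/h2/Ax.
Qed.

(** The generating space [D] is W_A cut by the H_u(T_i) for [i] outside [A], that is, the vectors of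
    [wold_part A] killed by all T_i^* with [i] in [A]; totality is then [lpow_total]. *)
Lemma wold_part_orthogonal_sum A :
  orthogonal_sum (wold_part A)
    (fun k : {ffun 'I_#|A| -> nat} =>
       mpow T k @` (\bigcap_(l : {ffun 'I_#|(~: A)%SET| -> nat})
                      (mpow T l @` wandering T A))).
Proof.
rewrite bigcap_mpow; [|exact: wandering_closed|]; last first.
  by move=> i; rewrite finset.in_setC; apply: wandering_reducing.
set D := _ `&` _.
have cD : closed_subspace D.
  apply: closed_subspaceI; first exact: wandering_closed.
  by apply: closed_subspace_bigcap => i _; apply: unitary_part_closed.
have DA : D `<=` wold_part A.
  move=> x [Ax Ux] i _; rewrite /component; case: ifPn => iA.
    exact: (shift_part_wandering (nT i) 0 (Ax i iA)).
  by apply: Ux; rewrite /= finset.in_setC.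
apply: orthogonal_sumP.
- exact: wold_part_closed.
- by move=> l; have [k -> _] := mpowE l; apply: lpow_closed.
- move=> l _ [x Dx <-]; have [k -> _] := mpowE l.
  by apply: lpow_reducing (DA _ Dx) => i _; apply: wold_part_reducing.
- move=> l l' ll' _ _ [x [Ax _] <-] [y [Ay _] <-].
  have [k -> kl] := mpowE l; have [k' -> kl'] := mpowE l'.
  have [j /eqP jl] : exists j, l j <> l' j.
    apply: contrapT => h; apply: ll'; apply/ffunP => j.
    by apply: contrapT => hj; apply: h; exists j.
  set i := enum_val j; have iA : i \in A := enum_valP j.
  have iA' : i \in enum A by rewrite mem_enum.
  (* At an index where the exponents differ, both vectors become different powers of the same [T i]
     applied to wandering vectors. *)
  have [w Tw ->] := lpow_wandering k (enum_uniq _) iA' (Ax i iA).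
  have [w' Tw' ->] := lpow_wandering k' (enum_uniq _) iA' (Ay i iA).
  rewrite kl kl'; move: jl; rewrite neq_ltn => /orP[] jl.
    exact: wandering_iter.
  by apply: inner_eq0C; apply: wandering_iter.
- move=> x Ax xD; apply: (perpI Ax); apply: (@lpow_total (enum A)) => //.
  + exact: enum_uniq.
  + exact: wold_part_closed.
  + move=> i; rewrite mem_enum => iA; split; first exact: wold_part_reducing.
    exact: wold_part_shift.
  + move=> k y Ay Ty; rewrite lpow_mpow; apply: (xD [ffun j => k (enum_val j)]).
    exists y => //; split=> [i iA|i]; first by apply: Ty; rewrite mem_enum.
    by rewrite /= finset.in_setC => /wold_part_unitary; apply.
Qed.

Lemma wold_part_set0 : wold_part finset.set0 =
  \bigcap_(l : {ffun 'I_#|[set: 'I_n]%SET| -> nat}) (mpow T l @` [set: H]).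
Proof.
rewrite bigcap_mpow => [||i _]; last 2 first.
- by apply/closed_subspaceP; split=> //; apply: closedT.
- by apply/reducingP.
rewrite setTI; apply/seteqP; split=> x hx i _.
  by apply: (@wold_part_unitary finset.set0) => //; rewrite finset.in_set0.
by rewrite /component finset.in_set0; apply: hx; rewrite /= finset.in_setT.
Qed.
End DoublyTwisted.
End HilbertSpaces.

Theorem theorem8p8 (R : realType) (H : hilbertType R) (Hsep : separable H)
    (n : nat) (n_ge2 : (2 <= n)%N)
    (T : 'I_n -> {linear H -> H}) (U : 'I_n -> 'I_n -> {linear H -> H})
    (TU : doubly_twisted T U) :
  (exists! HA : {set 'I_n} -> set H, wold_decomposition T HA) /\
  (forall HA : {set 'I_n} -> set H, wold_decomposition T HA ->
    (forall A : {set 'I_n}, A != finset.set0 ->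
       orthogonal_sum (HA A)
         (fun k : {ffun 'I_#|A| -> nat} =>
            mpow T k @` (\bigcap_(l : {ffun 'I_#|(~: A)%SET| -> nat})
                           (mpow T l @` wandering T A)))) /\
    HA finset.set0 =
      \bigcap_(l : {ffun 'I_#|[set: 'I_n]%SET| -> nat})
        (mpow T l @` [set: H])).
Proof.
split.
  exists (wold_part T); split; first exact: wold_part_decomposition TU.
  by move=> HA /(wold_decomposition_unique TU).
move=> HA /(wold_decomposition_unique TU) ->; split=> [A _|].
  exact: wold_part_orthogonal_sum TU A.
exact: wold_part_set0 TU.
Qed.
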